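(* Let $k$ and $i$ be integers with $1\le i\le k/2$, $k\equiv 2\pmod 4$ and $i\equiv 3\pmod 4$. Then for all integers $n\ge 0$, $$S_{k,i}(4n+2)\equiv 0\pmod 4.$$
   Context: Write $(a;q)_\infty=\prod_{m\ge 0}(1-aq^m)$, $(a)_\infty=(a;q)_\infty$, and $(a_1,\ldots,a_r;q)_\infty=(a_1;q)_\infty\cdots(a_r;q)_\infty$. For integers $k,i$ with $1\le i\le k/2$, the integers $S_{k,i}(n)$, $n\ge 0$, are given by the generating function $$\sum_{n\ge 0}S_{k,i}(n)q^n=\frac{(-q)_\infty\,(q^i,q^{k-i},q^k;q^k)_\infty}{(q)_\infty}.$$ Combinatorially (an overpartition of $n$ is a partition of $n$ in which the first occurrence of each integer may be overlined): if $i<k/2$, $S_{k,i}(n)$ is the number of overpartitions of $n$ whose non-overlined parts are not congruent to $0,\pm i$ modulo $k$; if $i=k/2$, it is the number of overpartitions of $n$ with no part divisible by $k/2$. *)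

(* Defs.v *)
From mathcomp Require Import all_boot all_order all_algebra.

Set Implicit Arguments.
Unset Strict Implicit.
Unset Printing Implicit Defensive.

Import Order.TTheory GRing.Theory Num.Theory.
Local Open Scope ring_scope.

(* Formal power series in q over the integers, as coefficient sequences. *)
Definition fps := nat -> int.

Definition fps_one : fps := fun n => (n == 0%N)%:R.

Definition fps_mul (f g : fps) : fps :=
  fun n => \sum_(j < n.+1) f j * g (n - j)%N.

(* [fps_inv_rev f n] lists the coefficients of 1/f from degree n down to
   degree 0.  The recursion is only meaningful for f with constant term 1; see
   [fps_mulfV]. *)
Fixpoint fps_inv_rev (f : fps) (n : nat) : seq int :=
  if n is m.+1 then
    let s := fps_inv_rev f m in (- \sum_(j < n) f j.+1 * s`_j) :: s
  else [:: 1].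

Definition fps_inv (f : fps) : fps := fun n => (fps_inv_rev f n)`_0.

(* The first N factors of (c q^s; q^t)_oo = \prod_(m >= 0) (1 - c q^(s + t m)). *)
Definition qpoch_fin (c : int) (s t N : nat) : {poly int} :=
  \prod_(m < N) (1 - c *: 'X^(s + t * m)).

(* The infinite product (c q^s; q^t)_oo as a formal power series.  When s and t
   are positive, the factors of index m >= n do not affect the coefficient of
   q^n, so the coefficients of the partial products are eventually constant and
   the value below is their limit; see [qpoch_limit]. *)
Definition qpoch (c : int) (s t : nat) : fps :=
  fun n => (qpoch_fin c s t n.+1)`_n.

(* S_{k,i}(n) is the coefficient of q^n in
   (-q; q)_oo (q^i, q^(k-i), q^k; q^k)_oo / (q; q)_oo. *)
Definition S_ (k i : nat) : fps :=
  fps_mul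
    (fps_mul (qpoch (-1) 1 1)
       (fps_mul (qpoch 1 i k) (fps_mul (qpoch 1 (k - i) k) (qpoch 1 k k))))
    (fps_inv (qpoch 1 1 1)).

Lemma nth_fps_inv_rev (f : fps) (n j : nat) :
  (j <= n)%N -> (fps_inv_rev f n)`_j = fps_inv f (n - j)%N.
Proof.
elim: n j => [|n IHn] [|j] //= lejn.
by rewrite subSS IHn.
Qed.

Lemma fps_mulfV (f : fps) : f 0%N = 1 -> fps_mul f (fps_inv f) =1 fps_one.
Proof.
move=> f0 [|n]; rewrite /fps_mul /fps_one.
  by rewrite big_ord_recl big_ord0 f0 mul1r addr0.
rewrite big_ord_recl f0 mul1r subn0 {1}/fps_inv /=.
apply/eqP; rewrite addrC subr_eq0; apply/eqP.
apply: eq_bigr => j _; rewrite nth_fps_inv_rev ?subSS //.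
by rewrite -ltnS.
Qed.

Lemma qpoch_limit (c : int) (s t n N : nat) :
  (0 < s)%N -> (0 < t)%N -> (n < N)%N ->
  (qpoch_fin c s t N)`_n = qpoch c s t n.
Proof.
move=> s0 t0; elim: N => [//|N IHN]; rewrite ltnS leq_eqVlt.
case/predU1P => [-> //|ltnN].
rewrite -IHN // /qpoch_fin big_ord_recr /= mulrBr mulr1 -scalerAr coefB coefZ.
rewrite coefMXn ifT ?mulr0 ?subr0 // (leq_trans ltnN) //.
by rewrite (leq_trans (leq_pmull N t0)) // leq_addl.
Qed.

Lemma qpoch_0 (c : int) (s t : nat) : (0 < s)%N -> qpoch c s t 0%N = 1.
Proof.
move=> s0; rewrite /qpoch /qpoch_fin big_ord_recl big_ord0 mulr1 muln0 addn0.
by rewrite coefB coefZ coef1 coefXn [0%N == s]eq_sym (gtn_eqF s0) mulr0 subr0.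
Qed.

(* Main.v *)
(** Modulo 4, (-q)_oo / (q)_oo is the product of the (1 + q^m) / (1 - q^m) =
    1 + 2 q^m / (1 - q^m), hence 1 + 2 \sum_(m, j >= 1) q^(m j), and by symmetry
    in m and j this is 1 + 2 \sum_(m >= 1) q^(m^2).  By the Jacobi triple
    product, (q^i, q^(k-i), q^k; q^k)_oo is the sum of the
    (-1)^n q^(k n (n - 1) / 2 + i n) over all integers n.  For k = 2 and i = 3
    modulo 4 these exponents are 0 or 3 modulo 4, whereas squares are 0 or 1, so
    no product of two terms has degree 2 modulo 4.  Power series are handled as
    polynomials modulo a power of q, and the triple product as the finite
    q-binomial theorem for \prod_(m < 2N) (q^(k N) - q^(i + k m)). *)

Require Import Defs.
From mathcomp Require Import all_boot all_order all_algebra.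
From mathcomp Require Import ring zify.

Set Implicit Arguments.
Unset Strict Implicit.
Unset Printing Implicit Defensive.

Import GRing.Theory.
Local Open Scope ring_scope.

(** * Gaussian binomial coefficients and the q-binomial theorem *)

Section GaussianBinomial.

Variables (R : comNzRingType) (Q : R).

(** The q-Pascal rule serves as definition, so no division by q-factorials is required and the
    coefficients exist in any commutative ring. *)
Fixpoint qbinom (n j : nat) : R :=
  match n, j with
  | _, 0 => 1
  | 0, _.+1 => 0
  | n'.+1, j'.+1 => qbinom n' j' + Q ^+ j'.+1 * qbinom n' j'.+1
  end.

Definition qfact (n : nat) : R := \prod_(m < n) (1 - Q ^+ m.+1).

Lemma qbinom0 n : qbinom n 0 = 1.
Proof. by case: n. Qed.

Lemma qbinomS n j :
  qbinom n.+1 j.+1 = qbinom n j + Q ^+ j.+1 * qbinom n j.+1.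
Proof. by []. Qed.

Lemma qbinom_small n j : (n < j)%N -> qbinom n j = 0.
Proof.
elim: n j => [|n IHn] [|j] //= lt_nj.
by rewrite !IHn ?mulr0 ?addr0 // ltnW.
Qed.

Lemma qfactS n : qfact n.+1 = qfact n * (1 - Q ^+ n.+1).
Proof. by rewrite /qfact big_ord_recr. Qed.

Lemma qbinom_fact a b : qfact a * qfact b * qbinom (a + b) a = qfact (a + b).
Proof.
(* Induction on [a + b]: both terms of the Pascal rule have the same smaller sum. They recombine by
   1 - Q^(a+b+2) = (1 - Q^(a+1)) + Q^(a+1) (1 - Q^(b+1)). *)
move: {2}(a + b)%N (erefl (a + b)%N) => n; elim: n a b => [|n IHn] [|a] [|b] //.
- by rewrite /qfact !big_ord0 /= !mul1r.
- by rewrite qbinom0 add0n mulr1 /qfact big_ord0 mul1r.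
- rewrite addn0 => -[an]; rewrite qbinomS (qbinom_small (ltnSn a)) mulr0 addr0.
  have := IHn a 0%N; rewrite addn0 => /(_ an) IH.
  by rewrite !qfactS -[in RHS]IH; ring.
- rewrite addSn => -[abn]; rewrite qbinomS mulrDr.
  have IH1 := IHn _ _ abn.
  have := IHn a.+1 b; rewrite addSnnS => /(_ abn) IH2.
  rewrite [qfact (a + b.+1).+1]qfactS.
  have -> : qfact a.+1 * qfact b.+1 * qbinom (a + b.+1) a =
     (1 - Q ^+ a.+1) * qfact (a + b.+1) by rewrite -IH1 qfactS; ring.
  have -> : qfact a.+1 * qfact b.+1 *
      (Q ^+ a.+1 * qbinom (a + b.+1) a.+1) =
     Q ^+ a.+1 * (1 - Q ^+ b.+1) * qfact (a + b.+1).
    by rewrite -[X in _ = _ * X]IH2 [qfact b.+1]qfactS; ring.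
  have -> : Q ^+ (a + b.+1).+1 = Q ^+ a.+1 * Q ^+ b.+1 by rewrite -exprD addSn.
  ring.
Qed.

(** The form homogeneous in [y] and [z] lets [y] be a power of q later on, which avoids negative
    exponents. The factor m = 0 is split off and the induction hypothesis is used at [z * Q]. *)
Lemma qbinomial_theorem n (y z : R) :
  \prod_(m < n) (y + z * Q ^+ m) =
  \sum_(j < n.+1) Q ^+ 'C(j, 2) * qbinom n j * z ^+ j * y ^+ (n - j).
Proof.
elim: n z => [|n IHn] z.
  by rewrite big_ord0 big_ord_recl big_ord0 /= !expr0 !mulr1 addr0.
rewrite big_ord_recl expr0 mulr1.
under eq_bigr => m _ do rewrite /= exprS mulrA.
rewrite IHn.
(* [h j] is the j-th term of the [y] part. Since 'C(j+1, 2) = 'C(j, 2) + j, [h j.+1] and the j-th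
   term of the [z] part add up by the Pascal rule. *)
pose h j := Q ^+ ('C(j, 2) + j) * qbinom n j * z ^+ j * y ^+ (n.+1 - j).
have hy : y * \sum_(j < n.+1)
    Q ^+ 'C(j, 2) * qbinom n j * (z * Q) ^+ j * y ^+ (n - j) =
    y ^+ n.+1 + \sum_(j < n.+1) h j.+1.
  transitivity (\sum_(j < n.+2) h j); last first.
    by rewrite big_ord_recl /h qbinom0 /= !expr0 !mul1r subn0.
  rewrite [in RHS]big_ord_recr /= [h n.+1]/h (qbinom_small (ltnSn n)).
  rewrite mulr0 !mul0r addr0.
  rewrite mulr_sumr; apply: eq_bigr => j _.
  rewrite /h subSn -1?ltnS // exprS exprD exprMn; ring.
rewrite mulrDl hy -addrA [in RHS]big_ord_recl qbinom0 /= expr0 !mul1r subn0.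
congr (_ + _); rewrite mulr_sumr -big_split; apply: eq_bigr => j _ /=.
rewrite /h /bump /= add0n add1n subSS binS bin1 exprMn !exprD !exprS; ring.
Qed.

End GaussianBinomial.

(** * Congruence modulo the ideal (x, y), used with x a power of q and y = 0 or 4 *)

Section CongruenceModTwoElements.

Variables (R : comNzRingType) (x y : R).

Definition eqmod (p r : R) := exists s t, p = r + x * s + y * t.

Lemma eqmod_refl p : eqmod p p.
Proof. by exists 0, 0; ring. Qed.

Lemma eqmod_trans p q r : eqmod p q -> eqmod q r -> eqmod p r.
Proof. by move=> [s [t ->]] [s' [t' ->]]; exists (s + s'), (t + t'); ring. Qed.

Lemma eqmod_sym p q : eqmod p q -> eqmod q p.
Proof. by move=> [s [t ->]]; exists (- s), (- t); ring. Qed.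

Lemma eqmodD p p' q q' : eqmod p p' -> eqmod q q' -> eqmod (p + q) (p' + q').
Proof. by move=> [s [t ->]] [s' [t' ->]]; exists (s + s'), (t + t'); ring. Qed.

Lemma eqmodM p p' q q' : eqmod p p' -> eqmod q q' -> eqmod (p * q) (p' * q').
Proof.
move=> [s [t ->]] [s' [t' ->]].
exists (p' * s' + s * (q' + x * s' + y * t') + s' * y * t).
by exists (p' * t' + t * (q' + y * t')); ring.
Qed.

Lemma eqmodMl p q q' : eqmod q q' -> eqmod (p * q) (p * q').
Proof. exact/eqmodM/eqmod_refl. Qed.

Lemma eqmod_sum n (f g : 'I_n -> R) :
  (forall j, eqmod (f j) (g j)) -> eqmod (\sum_j f j) (\sum_j g j).
Proof.
by move=> fg; elim/big_ind2: _ => [|*|j _]; [apply: eqmod_refl|apply: eqmodD|].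
Qed.

Lemma eqmod_cancel u v p q :
  eqmod (u * v) 1 -> eqmod (u * p) (u * q) -> eqmod p q.
Proof.
move=> uv1 upq.
have mulV r : eqmod (v * (u * r)) r.
  by rewrite mulrA [v * u]mulrC -{2}[r]mul1r; apply/eqmodM/eqmod_refl.
apply: (eqmod_trans (eqmod_sym (mulV p))).
exact: (eqmod_trans (eqmodMl _ upq) (mulV q)).
Qed.

End CongruenceModTwoElements.

Lemma eqmod_weaken (R : comNzRingType) (x x' y p r : R) :
  eqmod (x * x') 0 p r -> eqmod x y p r.
Proof. by move=> [s [t ->]]; exists (x' * s), 0; ring. Qed.

Lemma eqmodX_le (m n : nat) (y p r : {poly int}) :
  (m <= n)%N -> eqmod 'X^n 0 p r -> eqmod 'X^m y p r.
Proof. by move=> /subnKC <-; rewrite exprD; apply: eqmod_weaken. Qed.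

Lemma eqmod_invX (u : {poly int}) (m : nat) :
  u`_0 = 1 -> exists v, eqmod 'X^m 0 (u * v) 1.
Proof.
move=> u0; have /factor_theorem[w uw] : root (1 - u) 0.
  by rewrite /root hornerD hornerN hornerC horner_coef0 u0 subrr.
rewrite subr0 in uw.
(* As 1 - u = w X, the inverse is the geometric series of w X cut at order m. *)
exists (\sum_(l < m) (w * 'X) ^+ l), (- w ^+ m), 0.
have -> : u = - (w * 'X - 1) by rewrite -uw; ring.
by rewrite mulNr -subrX1 exprMn; ring.
Qed.

(** * q-factorials and Gaussian binomials modulo a power of q *)

Lemma qfactX_coef0 (k n : nat) : (0 < k)%N -> (qfact ('X^k : {poly int}) n)`_0 = 1.
Proof.
move=> k0; rewrite -horner_coef0 /qfact horner_prod big1 // => m _.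
by rewrite -exprM hornerD hornerN hornerC hornerXn expr0n muln_eq0 /=
  eqn0Ngt k0 subr0.
Qed.

(** Each factor beyond the first [a] is 1 - q^(k l) with l > a, hence 1 to this order. *)
Lemma qfactX_trunc (k a n : nat) : (a <= n)%N ->
  eqmod 'X^(k * a.+1) 0 (qfact ('X^k : {poly int}) n) (qfact 'X^k a).
Proof.
elim: n => [|n IHn]; first by rewrite leqn0 => /eqP->; apply: eqmod_refl.
rewrite leq_eqVlt => /predU1P[->|]; first exact: eqmod_refl.
rewrite ltnS => le_an; rewrite qfactS -[X in eqmod _ _ _ X]mulr1.
apply: eqmodM; first exact: IHn.
apply: (@eqmodX_le _ (k * n.+1)); first by rewrite leq_mul2l ltnS le_an orbT.
by exists (-1), 0; rewrite exprM; ring.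
Qed.

Lemma qbinomX_trunc (k a b : nat) : (0 < k)%N ->
  eqmod 'X^(k * (minn a b).+1) 0
    (qfact ('X^k : {poly int}) (a + b) * qbinom 'X^k (a + b) a) 1.
Proof.
move=> k0; set U := qfact _ _.
have [W UW] := eqmod_invX (k * (minn a b).+1) (qfactX_coef0 (a + b) k0).
have trunc c : (minn a b <= c)%N -> (c <= a + b)%N ->
    eqmod 'X^(k * (minn a b).+1) 0 U (qfact 'X^k c).
  move=> lec cle; apply: eqmodX_le (qfactX_trunc k cle).
  by rewrite leq_mul2l ltnS lec orbT.
(* Multiplied by the unit [U], the claim compares U^2 times the binomial with [U]; to this order the
   two factors [U] become the q-factorials of [a] and [b], and [qbinom_fact] applies. *)
apply: (eqmod_cancel UW); rewrite mulr1 mulrA.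
rewrite -[X in eqmod _ _ _ X](qbinom_fact _ a b).
apply/eqmodM/eqmod_refl; apply: eqmodM; apply: trunc;
  by rewrite ?geq_minl ?geq_minr ?leq_addr ?leq_addl.
Qed.

(** * Finite form of the Jacobi triple product *)

Lemma jacobi_product (k i N : nat) : (i <= k)%N ->
  \prod_(m < N + N) ('X^(k * N) + (- 'X^i) * 'X^k ^+ m : {poly int}) =
  (-1) ^+ N * 'X^(k * N * N + i * N + k * 'C(N, 2)) *
    (qpoch_fin 1 i k N * qpoch_fin 1 (k - i) k N).
Proof.
move=> le_ik; rewrite big_split_ord /=.
(* Lower half: q^(i + k m) is the smaller power, and factoring out -q^(i + k m) leaves 1 - q^(k (N -
   m) - i). *)
have -> : \prod_(m < N) ('X^(k * N) + (- 'X^i) * 'X^k ^+ m : {poly int}) =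
    (-1) ^+ N * 'X^(i * N + k * 'C(N, 2)) * qpoch_fin 1 (k - i) k N.
  have -> : qpoch_fin 1 (k - i) k N =
      \prod_(m < N) (1 - 'X^(k * (N - m) - i)).
    rewrite /qpoch_fin (reindex_inj rev_ord_inj); apply: eq_bigr => m _ /=.
    rewrite scale1r; congr (1 - 'X^ _); have := ltn_ord m; nia.
  have -> : (-1) ^+ N * 'X^(i * N + k * 'C(N, 2)) =
      \prod_(m < N) (- 'X^(i + k * m)) :> {poly int}.
    elim: (N) => [|M IHM]; first by rewrite big_ord0 !muln0 mulr1.
    rewrite big_ord_recr /= -IHM binS bin1 mulnS !mulnDr !exprD !exprS; ring.
  rewrite -big_split; apply: eq_bigr => m _ /=.
  rewrite -exprM !mulNr mulrBr mulr1 -!exprD opprB; congr ('X^ _ - _).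
  have := ltn_ord m; nia.
(* Upper half: here q^(k N) factors out and leaves 1 - q^(i + k m). *)
have -> : \prod_(m < N) ('X^(k * N) + (- 'X^i) * 'X^k ^+ (N + m) : {poly int}) =
    'X^(k * N * N) * qpoch_fin 1 i k N.
  have -> : 'X^(k * N * N) = \prod_(m < N) 'X^(k * N) :> {poly int}.
    by rewrite prodr_const card_ord exprM.
  rewrite -big_split; apply: eq_bigr => m _ /=.
  rewrite scale1r -exprM mulnDr !exprD; ring.
rewrite -addnA !exprD; ring.
Qed.

Lemma binD2 (a b : nat) : 'C(a + b, 2) = ('C(a, 2) + 'C(b, 2) + a * b)%N.
Proof.
elim: b => [|b IHb]; first by rewrite addn0 muln0 !addn0.
by rewrite addnS !binS !bin1 IHb; lia.
Qed.

(* The exponent of the j-th term of the finite Jacobi triple product of order N: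
   k n (n - 1) / 2 + i n for n = j - N in [-N, N]. *)
Definition theta_exp (k i N j : nat) : nat :=
  if (N <= j)%N then (k * 'C(j - N, 2) + i * (j - N))%N
  else (k * 'C((N - j).+1, 2) - i * (N - j))%N.

(** The left side is the exponent of q in the j-th term of the q-binomial expansion; the part
    independent of [j] is the monomial pulled out in [jacobi_product]. *)
Lemma theta_exp_shift (k i N j : nat) : (i <= k)%N -> (j <= N + N)%N ->
  (k * 'C(j, 2) + i * j + k * N * (N + N - j))%N =
  (k * N * N + i * N + k * 'C(N, 2) + theta_exp k i N j)%N.
Proof.
move=> le_ik le_j; rewrite /theta_exp; case: (leqP N j) => [le_Nj|lt_jN].
  have [n j_def] : exists n, j = (N + n)%N by exists (j - N)%N; lia.
  have [b N_def] : exists b, N = (n + b)%N by exists (N - n)%N; lia.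
  by rewrite j_def addKn binD2 subnDl N_def addKn; nia.
have [p N_def] : exists p, N = (j + p)%N by exists (N - j)%N; lia.
have -> : (N + N - j = N + p)%N by lia.
rewrite N_def addKn !binD2 binS bin1.
have := leq_mul le_ik (leqnn p); set ip := (i * p)%N; set kp := (k * p)%N.
set x := 'C(p, 2); set y := 'C(j, 2) => le_ip.
have -> : (k * (x + p) - ip = k * x + (kp - ip))%N by rewrite mulnDr addnBA.
have -> : (i * (j + p) = i * j + ip)%N by rewrite mulnDr.
suff : (k * (j + p) * (j + p + p) =
  k * (j + p) * (j + p) + k * (j * p) + k * x + k * x + kp)%N by lia.
have : (x + x + p = p * p)%N.
  by rewrite /x; elim: (p) => [|q IHq] //; rewrite binS bin1; lia.
rewrite /kp; nia.
Qed.

(** Ensures that the error of [qbinomX_trunc] in the j-th term, once multiplied by its theta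
    monomial, has order at least k N. Both cases rest on n <= 'C(n, 2) + 1. *)
Lemma theta_exp_ge (k i N j : nat) : (2 * i <= k)%N -> (j <= N + N)%N ->
  (k * N <= theta_exp k i N j + k * (minn j (N + N - j)).+1)%N.
Proof.
move=> le_ik le_j; rewrite /theta_exp; case: (leqP N j) => [le_Nj|lt_jN].
  have [n j_def] : exists n, j = (N + n)%N by exists (j - N)%N; lia.
  have [b N_def] : exists b, N = (n + b)%N by exists (N - n)%N; lia.
  rewrite j_def addKn; have -> : minn (N + n) (N + N - (N + n)) = b by lia.
  have : (n <= 'C(n, 2).+1)%N by elim: (n) => // m; rewrite binS bin1; lia.
  by rewrite N_def; nia.
have [p N_def] : exists p, N = (j + p)%N by exists (N - j)%N; lia.
have -> : minn j (N + N - j) = j by lia.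
rewrite N_def addKn binS bin1.
have : (p <= 'C(p, 2).+1)%N by elim: (p) => // m; rewrite binS bin1; lia.
set x := 'C(p, 2) => le_p.
have : (i * p <= k * p)%N by nia.
have : (i * p <= k * x.+1)%N by nia.
rewrite !mulnDr mulnS; nia.
Qed.

(** Modulo 4 the exponent is n (n - 1) + 3 n = (n + 1)^2 - 1, hence 0 for even n and 3 for odd n. *)
Lemma theta_exp_mod4 (k i N j : nat) :
  (2 * i <= k)%N -> (k = 2 %[mod 4])%N -> (i = 3 %[mod 4])%N ->
  ((theta_exp k i N j %% 4 == 0) || (theta_exp k i N j %% 4 == 3))%N.
Proof.
move=> le_ik k4 i4; rewrite /theta_exp.
have [a k_def] : exists a, k = (4 * a + 2)%N by exists (k %/ 4)%N; lia.
have [b i_def] : exists b, i = (4 * b + 3)%N by exists (i %/ 4)%N; lia.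
have bin_even q : ('C(q + q, 2) + q = 2 * (q * q))%N.
  by elim: q => // q IHq; rewrite addSn [(q + q.+1)%N]addnS !binS bin0 !bin1; nia.
have parity n : exists q, (n = q + q \/ n = (q + q).+1)%N by exists n./2; lia.
case: leqP => [_|_].
  set n := (j - N)%N; have [q [->|->]] := parity n; move: (bin_even q).
    set c := 'C(_, 2) => c_def.
    have -> : (k * c + i * (q + q) = 4 * (a * c + q * q + 2 * b * q + q))%N.
      by rewrite k_def i_def; nia.
    lia.
  rewrite binS bin1; set c := 'C(_, 2) => c_def.
  have -> : (k * (c + (q + q)) + i * (q + q).+1 =
      4 * (a * (c + (q + q)) + q * q + 2 * b * q + 2 * q + b) + 3)%N.
    by rewrite k_def i_def; nia.
  lia.
set p := (N - j)%N.
(* This makes the natural-number subtraction in [theta_exp] exact. *)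
have : (i * p <= k * 'C(p.+1, 2))%N.
  have : (p <= 2 * 'C(p.+1, 2))%N.
    by elim: (p) => // m IHm; rewrite binS bin1; lia.
  nia.
have [q [->|->]] := parity p; move: (bin_even q).
  rewrite binS bin1; set c := 'C(_, 2) => c_def.
  have -> : (k * (c + (q + q)) = 4 * (a * (c + (q + q)) + q * q) + 2 * q)%N.
    by rewrite k_def; nia.
  have -> : (i * (q + q) = 4 * (2 * (b * q) + q) + 2 * q)%N by rewrite i_def; nia.
  lia.
rewrite !binS bin0 !bin1; set c := 'C(_, 2) => c_def.
set d := (c + (q + q) + _)%N.
have -> : (k * d = 4 * (a * d + q * q + q) + 2 * q + 2)%N by rewrite k_def /d; nia.
have -> : (i * (q + q).+1 = 4 * (2 * (b * q) + q + b) + 2 * q + 3)%N.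
  by rewrite i_def; nia.
lia.
Qed.

Lemma jacobi_triple_trunc (k i N : nat) : (0 < k)%N -> (2 * i <= k)%N ->
  eqmod ('X^(k * N) : {poly int}) 0
    (qpoch_fin 1 i k N * (qpoch_fin 1 (k - i) k N * qpoch_fin 1 k k (N + N)))
    (\sum_(j < (N + N).+1) (-1) ^+ (N + j) * 'X^(theta_exp k i N j)).
Proof.
move=> k0 le_ik; have le_ik' : (i <= k)%N by lia.
set E := (k * N * N + i * N + k * 'C(N, 2))%N.
set F := _ * _; set T := \sum_(j < _) _.
(* The q-binomial theorem yields both sides multiplied by q^E, so the congruence is proved to order
   E + k N and q^E is cancelled. *)
suff [s [t FT]] : eqmod ('X^E * 'X^(k * N) : {poly int}) 0 ('X^E * F) ('X^E * T).
  exists s, 0; apply: (mulfI (monic_neq0 (monicXn int E))).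
  by rewrite FT; ring.
have FE : 'X^E * F = (-1) ^+ N * (qfact 'X^k (N + N) *
    \prod_(m < N + N) ('X^(k * N) + (- 'X^i) * 'X^k ^+ m)).
  have -> : qfact 'X^k (N + N) = qpoch_fin 1 k k (N + N).
    by apply: eq_bigr => m _; rewrite scale1r -exprM mulnS.
  rewrite jacobi_product //.
  transitivity (((-1) ^+ N * (-1) ^+ N) * ('X^E * F)); last by rewrite /F /E; ring.
  by rewrite -exprMn mulrNN mulr1 expr1n mul1r.
rewrite FE qbinomial_theorem /T !mulr_sumr; apply: eqmod_sum => j.
have le_j : (j <= N + N)%N by rewrite -ltnS.
have := qbinomX_trunc j (N + N - j) k0; rewrite subnKC // => qbin1.
have expE : 'X^k ^+ 'C(j, 2) * ('X^i) ^+ j * 'X^(k * N) ^+ (N + N - j) =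
    'X^E * 'X^(theta_exp k i N j) :> {poly int}.
  by rewrite -!exprM -!exprD theta_exp_shift.
have -> : (-1) ^+ N * (qfact 'X^k (N + N) *
   ('X^k ^+ 'C(j, 2) * qbinom 'X^k (N + N) j * (- 'X^i) ^+ j *
     'X^(k * N) ^+ (N + N - j))) =
   'X^E * 'X^(theta_exp k i N j) * (-1) ^+ (N + j) *
     (qfact 'X^k (N + N) * qbinom 'X^k (N + N) j) :> {poly int}.
  by rewrite -expE [(- 'X^i) ^+ j]exprNn exprD; ring.
have [s [t ->]] := qbin1.
have shiftE : 'X^(theta_exp k i N j) * 'X^(k * (minn j (N + N - j)).+1) = 'X^(k * N) *
  'X^(theta_exp k i N j + k * (minn j (N + N - j)).+1 - k * N) :> {poly int}.
  by rewrite -!exprD subnKC // theta_exp_ge.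
exists ((-1) ^+ (N + j) *
  'X^(theta_exp k i N j + k * (minn j (N + N - j)).+1 - k * N) * s), 0.
transitivity ('X^E * ((-1) ^+ (N + j) * 'X^(theta_exp k i N j)) +
    'X^E * (-1) ^+ (N + j) * s *
    ('X^(theta_exp k i N j) * 'X^(k * (minn j (N + N - j)).+1))).
  by ring.
by rewrite shiftE; ring.
Qed.

(** * The quotient (-q)_oo / (q)_oo modulo 4 *)

Lemma prod_1addr_mod4 (x : {poly int}) N (u g : 'I_N -> {poly int}) :
  (forall m, eqmod x 4 (u m) ((1 - u m) * g m)) ->
  eqmod x 4 (\prod_m (1 + u m)) (\prod_m (1 - u m) * (1 + 2 * \sum_m g m)).
Proof.
elim: N u g => [|N IHN] u g ug.
  by rewrite !big_ord0 mulr0 addr0 mulr1; apply: eqmod_refl.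
rewrite !big_ord_recr /=; set v := u ord_max; set h := g ord_max.
(* [h] stands for v / (1 - v), so that 1 + v = (1 - v) + 2 v becomes (1 - v) (1 + 2 h). *)
have /(eqmodM (IHN _ _ (fun m => ug (widen_ord (leqnSn N) m)))) step :
    eqmod x 4 (1 + v) ((1 - v) * (1 + 2 * h)).
  have -> : 1 + v = 1 - v + 2 * v by ring.
  have -> : (1 - v) * (1 + 2 * h) = 1 - v + 2 * ((1 - v) * h) by ring.
  by apply/eqmodD/eqmodMl/ug/eqmod_refl.
apply: (eqmod_trans step) => /=; set P := \prod_(m < N) _; set G := \sum_(m < N) _.
(* The only discrepancy is the cross term 2 G * 2 h, a multiple of 4. *)
by exists 0, (P * (1 - v) * G * h); ring.
Qed.

(* The off-diagonal terms of the symmetric sum \sum_(m, j) X^(m j) cancel in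
   pairs modulo 2. *)
Lemma double_divisor_sum_mod4 (x : {poly int}) N :
  eqmod x 4 (2 * \sum_(m < N) \sum_(j < N) 'X^(m.+1 * j.+1))
    (2 * \sum_(m < N) 'X^(m.+1 ^ 2)).
Proof.
exists 0; elim: N => [|N [t IHN]]; first by exists 0; rewrite !big_ord0; ring.
exists (t + \sum_(j < N) 'X^(N.+1 * j.+1)).
have -> : \sum_(m < N.+1) \sum_(j < N.+1) 'X^(m.+1 * j.+1) =
  \sum_(m < N) \sum_(j < N) 'X^(m.+1 * j.+1) +
  2 * \sum_(j < N) 'X^(N.+1 * j.+1) + 'X^(N.+1 ^ 2) :> {poly int}.
  rewrite big_ord_recr [X in _ + X = _]big_ord_recr /=.
  under eq_bigr => m _ do rewrite big_ord_recr /= [(m.+1 * N.+1)%N]mulnC.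
  by rewrite big_split /= mulnn; ring.
rewrite big_ord_recr /= !mulrDr IHN; ring.
Qed.

Lemma overpartition_product_mod4 N :
  eqmod ('X^(N.+1) : {poly int}) 4 (qpoch_fin (-1) 1 1 N)
    (qpoch_fin 1 1 1 N * (1 + 2 * \sum_(m < N) 'X^(m.+1 ^ 2))).
Proof.
have -> : qpoch_fin (-1) 1 1 N = \prod_(m < N) (1 + 'X^(m.+1)).
  by apply: eq_bigr => m _; rewrite scaleN1r opprK mul1n add1n.
have -> : qpoch_fin 1 1 1 N = \prod_(m < N) (1 - 'X^(m.+1)).
  by apply: eq_bigr => m _; rewrite scale1r mul1n add1n.
apply: (@eqmod_trans _ _ _ _ (\prod_(m < N) (1 - 'X^(m.+1)) *
    (1 + 2 * \sum_(m < N) \sum_(j < N) 'X^(m.+1 * j.+1)))); last first.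
  by apply/eqmodMl/eqmodD/double_divisor_sum_mod4/eqmod_refl.
(* With u = q^(m+1), (1 - u) (u + ... + u^N) = u - u^(N+1), and the last power is divisible by
   q^(N+1). *)
apply: prod_1addr_mod4 => m; exists ('X^(m.+1 * N.+1 - N.+1)), 0.
have -> : \sum_(j < N) 'X^(m.+1 * j.+1) =
    'X^(m.+1) * \sum_(j < N) 'X^(m.+1) ^+ j :> {poly int}.
  by rewrite mulr_sumr; apply: eq_bigr => j _; rewrite -exprM -exprD mulnS.
rewrite -exprD subnKC ?leq_pmull // mulr0 addr0.
have := subrX1 ('X^(m.+1) : {poly int}) N; rewrite -exprM mulnS exprD => H.
transitivity ('X^(m.+1) * (1 - 'X^(m.+1 * N)) + 'X^(m.+1) * 'X^(m.+1 * N) : {poly int}).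
  by ring.
by rewrite -[1 - _]opprB H; ring.
Qed.

(** * From power series to truncated polynomials *)

Definition fps_trunc (N : nat) (f : fps) (p : {poly int}) :=
  forall n, (n < N)%N -> p`_n = f n.

Lemma fps_trunc_mul N f g p r : fps_trunc N f p -> fps_trunc N g r ->
  fps_trunc N (fps_mul f g) (p * r).
Proof.
move=> fp gr n lt_nN; rewrite coefM; apply: eq_bigr => j _.
by rewrite fp ?gr // (leq_ltn_trans _ lt_nN) ?leq_subr // -ltnS.
Qed.

Lemma fps_trunc_qpoch N M c s t : (0 < s)%N -> (0 < t)%N -> (N <= M)%N ->
  fps_trunc N (qpoch c s t) (qpoch_fin c s t M).
Proof.
move=> s0 t0 le_NM n lt_nN.
by apply: qpoch_limit => //; apply: leq_trans le_NM.
Qed.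

Lemma eqmodX_coef N (p r : {poly int}) n : (n < N)%N ->
  eqmod 'X^N 4 p r -> (p`_n = r`_n %[mod 4])%Z.
Proof.
move=> lt_nN [s [t ->]]; rewrite !coefD coefXnM lt_nN addr0.
by rewrite mulr_natl coefMn -[t`_n *+ 4]mulr_natr addrC modzMDl.
Qed.

Lemma eq_trunc_eqmodX N (p r : {poly int}) :
  (forall n, (n < N)%N -> p`_n = r`_n) -> eqmod 'X^N 0 p r.
Proof.
move=> pr; exists (drop_poly N p - drop_poly N r), 0.
rewrite mulr0 addr0 -{1}[p](poly_take_drop N) -{1}[r](poly_take_drop N).
have -> : take_poly N p = take_poly N r.
  by apply/polyP => n; rewrite !coef_take_poly; case: ifP => // /pr.
ring.
Qed.

Lemma coef_theta_shift (I : finType) (s e : I -> nat) a n :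
  (forall j, a + e j != n)%N ->
  ('X^a * \sum_j (-1) ^+ (s j) * 'X^(e j) : {poly int})`_n = 0.
Proof.
move=> ne; rewrite mulr_sumr coef_sum big1 // => j _.
rewrite mulrCA -exprD -signr_odd mulr_sign.
by case: odd; rewrite ?coefN coefXn eq_sym (negbTE (ne j)) ?oppr0.
Qed.

Theorem mainTheorem6 (k i : nat) (hi : (1 <= i)%N) (hik : (2 * i <= k)%N)
    (hk4 : (k = 2 %[mod 4])%N) (hi4 : (i = 3 %[mod 4])%N) (n : nat) :
  (S_ k i (4 * n + 2)%N = 0 %[mod 4])%Z.
Proof.
(* The least order of truncation that keeps the coefficient of degree 4n + 2. *)
set M := (4 * n + 2).+1.
have k0 : (0 < k)%N by lia.
pose A := qpoch_fin (-1) 1 1 M; pose B := qpoch_fin 1 1 1 M.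
pose F := qpoch_fin 1 i k M *
  (qpoch_fin 1 (k - i) k M * qpoch_fin 1 k k (M + M)).
pose V := \poly_(j < M) fps_inv (qpoch 1 1 1) j.
pose phi : {poly int} := 1 + 2 * \sum_(m < M) 'X^(m.+1 ^ 2).
pose Theta : {poly int} :=
  \sum_(j < (M + M).+1) (-1) ^+ (M + j) * 'X^(theta_exp k i M j).
have truncV : fps_trunc M (fps_inv (qpoch 1 1 1)) V.
  by move=> j lt_jM; rewrite coef_poly lt_jM.
have truncS : fps_trunc M (S_ k i) (A * F * V).
  apply: fps_trunc_mul => //; apply: fps_trunc_mul.
    exact: fps_trunc_qpoch.
  by do 2?apply: fps_trunc_mul; apply: fps_trunc_qpoch; lia.
have BV : eqmod 'X^M 4 (B * V) 1.
  apply: (@eqmodX_le M M) => //; apply: eq_trunc_eqmodX => j lt_jM.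
  have /fps_trunc_mul/(_ truncV)-> // : fps_trunc M (qpoch 1 1 1) B.
    exact: fps_trunc_qpoch.
  by rewrite fps_mulfV ?qpoch_0 // coef1.
have Aphi : eqmod 'X^M 4 A (B * phi).
  rewrite /A; have [s [t ->]] := overpartition_product_mod4 M.
  (* The congruence holds to order M + 1; the spare factor q goes into the witness. *)
  by exists ('X * s), t; rewrite -/B -/phi exprS; ring.
have Ftheta : eqmod 'X^M 4 F Theta.
  apply: eqmodX_le (jacobi_triple_trunc M k0 hik).
  by rewrite leq_pmull.
have Sphi : eqmod 'X^M 4 (A * F * V) (phi * Theta).
  apply: (@eqmod_trans _ _ _ _ (B * phi * Theta * V)).
    by apply/eqmodM/eqmod_refl/eqmodM.
  have -> : B * phi * Theta * V = phi * Theta * (B * V) by ring.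
  by rewrite -[X in eqmod _ _ _ X]mulr1; exact: (eqmodMl (phi * Theta) BV).
have ltM : (4 * n + 2 < M)%N by [].
rewrite -truncS // (eqmodX_coef ltM Sphi).
(* 0 or 1 plus 0 or 3 is never 2 modulo 4. *)
have coef0 a : ((a %% 4 == 0) || (a %% 4 == 1))%N ->
    ('X^a * Theta)`_(4 * n + 2) = 0.
  move=> a4; apply: coef_theta_shift => j.
  by have := theta_exp_mod4 M j hik hk4 hi4; lia.
(* The constant 1 is written as q^0, so [coef0] covers it as well as the squares. *)
rewrite /phi -(expr0 'X) mulrDl coefD coef0 // add0r.
rewrite -mulrA mulr_natl coefMn mulr_suml coef_sum big1 ?mul0rn // => m _.
apply: coef0; have := modnMm m.+1 m.+1 4; rewrite mulnn => <-.
by have := ltn_pmod m.+1 (isT : 0 < 4)%N; case: (m.+1 %% 4)%N => [|[|[|[|]]]].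
Qed.
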